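(* For any fixed real $p>0$ and any $D_0\ge 1$, there exists a graph--matrix pair $(\mathcal{G}^*,\mathbf{W}^* )$ (with $\lambda_{\mathbf{W}^*}<1$) such that $$D_{\mathcal{G}^*}\ge D_0,\qquad \tau_{\mathbf{W}^*}=D_{\mathcal{G}^*}^{\,p}.$$
   Context: A graph--matrix pair $(\mathcal{G},\mathbf{W})$ consists of a connected undirected graph $\mathcal{G}$ on a finite node set $\{1,\dots,n\}$ (no self-loops) and a mixing matrix $\mathbf{W}$ on $\mathcal{G}$: a real $n\times n$ matrix that is entrywise nonnegative, symmetric, doubly stochastic, and such that for all $i\ne j$, $[\mathbf{W}]_{ij}>0$ if and only if $\{i,j\}$ is an edge of $\mathcal{G}$. $D_{\mathcal{G}}$ is the diameter of $\mathcal{G}$. With $\mathbf{J}=\mathbf{1}\mathbf{1}^\top/n$ and $\|\cdot\|_2$ the spectral norm, $\lambda_{\mathbf{W}}:=\|\mathbf{W}-\mathbf{J}\|_2$, and $\tau_{\mathbf{W}}:=1/(1-\lambda_{\mathbf{W}})$ when $\lambda_{\mathbf{W}}<1$. *)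

(* Defs.v *)
From mathcomp Require Import all_boot all_order all_algebra.
From mathcomp Require Import all_classical all_reals all_analysis.

Set Implicit Arguments.
Unset Strict Implicit.
Unset Printing Implicit Defensive.

Import Order.TTheory GRing.Theory Num.Theory.

Local Open Scope classical_set_scope.
Local Open Scope ring_scope.

Definition connected_graph (T : finType) (e : rel T) : Prop :=
  [/\ (0 < #|T|)%N, symmetric e, irreflexive e & forall x y, connect e x y].

Definition walk_of_length (T : finType) (e : rel T) (k : nat) (x y : T) : bool :=
  [exists s : k.-tuple T, path e x s && (last x s == y)].

(* Only lengths k < #|T| need to be tried, since a shortest walk visits each
   vertex at most once. If y is unreachable from x, the value is #|T|. *)
Definition graph_dist (T : finType) (e : rel T) (x y : T) : nat :=
  \big[minn/#|T|]_(k < #|T| | walk_of_length e k x y) (k : nat).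

Definition diameter (T : finType) (e : rel T) : nat :=
  (\max_(x : T) \max_(y : T) graph_dist e x y)%N.

Definition doubly_stochastic (R : realType) n (W : 'M[R]_n) : Prop :=
  (forall i, \sum_j W i j = 1) /\ (forall j, \sum_i W i j = 1).

Definition mixing_matrix (R : realType) n (e : rel 'I_n) (W : 'M[R]_n) : Prop :=
  [/\ forall i j, 0 <= W i j,
      W^T = W,
      doubly_stochastic W &
      forall i j, i != j -> (0 < W i j <-> e i j)].

Definition graph_matrix_pair (R : realType) n (e : rel 'I_n) (W : 'M[R]_n) :
    Prop :=
  connected_graph e /\ mixing_matrix e W.

(* The norm `|x| carried by 'cV[R]_n in MathComp-Analysis is the max norm. *)
Definition euclidean_norm (R : realType) n (x : 'cV[R]_n) : R :=
  Num.sqrt (\sum_i x i 0 ^+ 2).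

Definition spectral_norm (R : realType) m n (A : 'M[R]_(m, n)) : R :=
  sup [set euclidean_norm (A *m x) | x in [set x | euclidean_norm x <= 1]].

Definition averaging_mx (R : realType) n : 'M[R]_n :=
  let one : 'cV[R]_n := const_mx 1 in n%:R^-1 *: (one *m one^T).

Definition mixing_lambda (R : realType) n (W : 'M[R]_n) : R :=
  spectral_norm (W - averaging_mx R n).

(* Meaningful only when mixing_lambda W < 1. *)
Definition mixing_tau (R : realType) n (W : 'M[R]_n) : R :=
  1 / (1 - mixing_lambda W).

(* Main.v *)
Require Import Defs.
From mathcomp Require Import all_boot all_order all_algebra.
From mathcomp Require Import all_classical all_reals all_analysis.
From mathcomp Require Import ring lra.

(** The graph is the Cayley graph of the group F^(m+1), F a finite field with
q elements, whose generators are the nonzero vectors c (1, a, ..., a^m) with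
a, c in F.  It is at once a long graph and a good expander, with constants that
are explicit, and this is what makes every exponent p, however small,
reachable.

Spectrum.  Let P_a be the operator that averages a function along the lines of
direction (1, a, ..., a^m).  The P_a are commuting orthogonal projections, and
by Vandermonde any m+1 of these directions span F^(m+1), so that the product of
any m+1 distinct P_a kills the functions of sum zero
([mxprod_line_avg_kill]).  On those functions the sum of the P_a
therefore has norm at most m ([sqnorm_sum_proj_le]): in a common eigenbasis at most m of
them can be 1 on a given vector.  The bound is attained by a function of the
form g(phi(y)), where phi is the linear form whose coefficients are those of a
polynomial with m roots in F ([sum_slow_mode]): P_a fixes it when a is a root
and kills it otherwise.  Hence W_t = (1-t) I + (t/q) sum_a P_a, whose
off-diagonal support is the same graph for all t in (0, 1], satisfies
lambda = 1 - t (1 - m/q) exactly ([mixing_lambda_lazy_walk]).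

Diameter.  A walk of length at most m uses at most m directions; the linear form
attached to a monic polynomial of degree m vanishing at their parameters is
constant along the walk, but separates 0 from the last basis vector.  So the
diameter exceeds m ([diameter_gt]).

Conclusion.  Take m large, so that the diameter D is at least D0 and
D^p >= 2, and q >= 2m, so that 1 - m/q >= 1/2.  As D
does not depend on t and lambda is affine in t, the value
t = D^(-p) / (1 - m/q), which lies in (0, 1], gives 1 - lambda = D^(-p). *)

Set Implicit Arguments.
Unset Strict Implicit.
Unset Printing Implicit Defensive.

Import Order.TTheory GRing.Theory Num.Theory.

Local Open Scope ring_scope.

(** * Sums of commuting orthogonal projections *)

Section SquaredNorm.
Variables (R : realFieldType) (n : nat).
Implicit Types (x u w : 'cV[R]_n) (P : 'M[R]_n).

Definition sqnorm x : R := \sum_i x i 0 ^+ 2.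

Lemma sqnormE x : sqnorm x = (x^T *m x) 0 0.
Proof. by rewrite mxE; apply: eq_bigr => i _; rewrite mxE expr2. Qed.

Lemma sqnorm_ge0 x : 0 <= sqnorm x.
Proof. by apply: sumr_ge0 => i _; exact: sqr_ge0. Qed.

Lemma sqnorm_gt0 x i : x i 0 != 0 -> 0 < sqnorm x.
Proof.
move=> xi; rewrite /sqnorm (bigD1 i) //= ltr_pwDl ?exprn_even_gt0 //.
by apply: sumr_ge0 => j _; exact: sqr_ge0.
Qed.

Lemma sqnormZ c x : sqnorm (c *: x) = c ^+ 2 * sqnorm x.
Proof.
by rewrite mulr_sumr; apply: eq_bigr => i _; rewrite mxE exprMn.
Qed.

(** Pythagoras: the image and the kernel of a symmetric matrix are orthogonal. *)
Lemma sqnormD_proj P u w : P^T = P -> P *m u = u -> P *m w = 0 ->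
  sqnorm (u + w) = sqnorm u + sqnorm w.
Proof.
move=> Psym Pu Pw.
have uw : u^T *m w = 0 by rewrite -Pu trmx_mul Psym -mulmxA Pw mulmx0.
have wu : w^T *m u = 0 by rewrite -[u]trmxK -trmx_mul uw trmx0.
have DT : (u + w)^T = u^T + w^T by apply/matrixP => i j; rewrite !mxE.
by rewrite !sqnormE DT mulmxDl !mulmxDr uw wu addr0 add0r mxE.
Qed.

Lemma sqnorm_projC P x : P^T = P -> P *m P = P ->
  sqnorm x = sqnorm (P *m x) + sqnorm (x - P *m x).
Proof.
move=> Psym Pid; rewrite -(@sqnormD_proj P) //.
- by rewrite addrC subrK.
- by rewrite mulmxA Pid.
- by rewrite mulmxBr mulmxA Pid subrr.
Qed.

End SquaredNorm.

Section CommutingProjections.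
Variables (R : realFieldType) (I : eqType) (n : nat) (P : I -> 'M[R]_n).
Hypothesis Psym : forall a, (P a)^T = P a.
Hypothesis Pid : forall a, P a *m P a = P a.
Hypothesis Pcomm : forall a b, P a *m P b = P b *m P a.

Definition mxprod (s : seq I) : 'M[R]_n := foldr (fun a M => P a *m M) 1%:M s.

Lemma comm_mxprod (Q : 'M[R]_n) s :
  (forall a, Q *m P a = P a *m Q) -> Q *m mxprod s = mxprod s *m Q.
Proof.
move=> QP; elim: s => [|a s IH] /=; first by rewrite mulmx1 mul1mx.
by rewrite mulmxA QP -!mulmxA IH.
Qed.

(** In a common eigenbasis each P a is 0 or 1, and a vector killed by all
products of k+1 projections sees at most k ones.  The induction on s avoids the
eigenbasis: split x orthogonally as y + z with y = P a x.  On z the projection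
P a is 0 and the hypothesis is unchanged; on y it is 1, and products of only k
of the remaining projections already vanish, so one unit moves from k to the
shift c.  The shift is in the statement so that the two bounds stay squares
with the same constant k + c, which lets them be added by Pythagoras. *)
Lemma sqnorm_sum_proj_le (s : seq I) (k : nat) (c : R) (x : 'cV[R]_n) :
    0 <= c ->
    (forall t, subseq t s -> size t = k.+1 -> mxprod t *m x = 0) ->
  sqnorm ((\sum_(a <- s) P a) *m x + c *: x) <= (k%:R + c) ^+ 2 * sqnorm x.
Proof.
elim: s k c x => [|a s IH] k c x c0 kill.
  rewrite big_nil mul0mx add0r sqnormZ ler_wpM2r ?sqnorm_ge0 //.
  by rewrite ler_sqr ?nnegrE ?addr_ge0 // lerDr.
set N := \sum_(b <- s) P b; set y := P a *m x; set z := x - y.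
have PN : P a *m N = N *m P a.
  by rewrite mulmx_sumr mulmx_suml; apply: eq_bigr.
have Py : P a *m y = y by rewrite /y mulmxA Pid.
have Pz : P a *m z = 0 by rewrite mulmxBr Py subrr.
have -> : (\sum_(b <- a :: s) P b) *m x + c *: x =
    (N *m y + (c + 1) *: y) + (N *m z + c *: z).
  have xE : x = y + z by rewrite addrC subrK.
  rewrite big_cons -/N mulmxDl -/y [in N *m x]xE [in c *: x]xE mulmxDr.
  move: (N *m y) (N *m z) (y) (z) => u w y' z'.
  by apply/matrixP => i j; rewrite !mxE; ring.
rewrite (@sqnormD_proj _ _ (P a)) //; last 2 first.
- by rewrite mulmxDr -scalemxAr mulmxA PN -mulmxA Py.
- by rewrite mulmxDr -scalemxAr mulmxA PN -mulmxA Pz mulmx0 scaler0 addr0.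
rewrite [sqnorm x](@sqnorm_projC _ _ (P a)) // -/y -/z mulrDr lerD //.
- case: k kill => [|k] kill.
    have -> : y = 0.
      by have := kill [:: a]; rewrite /= mulmx1 eqxx -/y; apply; rewrite ?sub0seq.
    rewrite mulmx0 scaler0 addr0 -(scale0r 0) sqnormZ expr0n /= mul0r.
    by rewrite mulr_ge0 ?sqr_ge0 ?sqnorm_ge0.
  rewrite -natr1 -addrA [1 + c]addrC; apply: IH; first by rewrite addr_ge0.
  move=> t ts st; have := kill (a :: t); rewrite /= eqxx st => /(_ ts erefl).
  by rewrite (@comm_mxprod (P a)) // -mulmxA.
- apply: IH => // t ts st.
  have tx : mxprod t *m x = 0.
    by apply: kill => //; apply: subseq_trans ts (subseq_cons _ _).
  by rewrite mulmxBr tx mulmxA -(@comm_mxprod (P a)) // -mulmxA tx mulmx0 subrr.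
Qed.

End CommutingProjections.

(** * The spectral norm of a matrix whose norm bound is attained *)

Section SpectralNorm.
Variables (R : realType) (n : nat).

(** The supremum that defines the norm is attained at h normalized, so an upper
bound that is also an eigenvalue is the norm. *)
Lemma spectral_normE (A : 'M[R]_n) (mu : R) (h : 'cV[R]_n) : 0 <= mu ->
    (forall x, sqnorm (A *m x) <= mu ^+ 2 * sqnorm x) ->
    A *m h = mu *: h -> 0 < sqnorm h ->
  spectral_norm A = mu.
Proof.
move=> mu0 Ale Ah h0.
have ub : ubound [set euclidean_norm (A *m x) | x in
    [set x : 'cV[R]_n | euclidean_norm x <= 1]]%classic mu.
  move=> _ [x /= x1 <-]; rewrite /euclidean_norm -/(sqnorm _).
  apply: le_trans (_ : Num.sqrt (mu ^+ 2 * sqnorm x) <= _).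
    by rewrite ler_sqrt ?mulr_ge0 ?sqr_ge0 ?sqnorm_ge0.
  by rewrite sqrtrM ?sqr_ge0 // sqrtr_sqr ger0_norm // ler_piMr.
have hmem : [set euclidean_norm (A *m x) | x in
    [set x : 'cV[R]_n | euclidean_norm x <= 1]]%classic mu.
  have s0 : 0 < Num.sqrt (sqnorm h) by rewrite sqrtr_gt0.
  have hh : sqnorm ((Num.sqrt (sqnorm h))^-1 *: h) = 1.
    by rewrite sqnormZ exprVn sqr_sqrtr ?ltW // mulVf // gt_eqF.
  exists ((Num.sqrt (sqnorm h))^-1 *: h) => /=.
    by rewrite /euclidean_norm -/(sqnorm _) hh sqrtr1.
  rewrite -scalemxAr Ah scalerA mulrC -scalerA /euclidean_norm -/(sqnorm _).
  by rewrite sqnormZ hh mulr1 sqrtr_sqr ger0_norm.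
apply/le_anti/andP; split; first by apply: ge_sup => //; exists mu.
by apply: ub_le_sup => //; exists mu.
Qed.

End SpectralNorm.

(** * The moment curve *)

Section MomentCurve.
Variables (F : finFieldType) (m : nat).
Local Notation X := 'cV[F]_m.+1.
Implicit Types (f : {poly F}) (y z u : X).

Definition moment (a : F) : X := \col_i a ^+ i.

(** The pairing that identifies polynomials of degree at most m with linear
forms on F^(m+1): on the moment curve it is evaluation ([coef_form_moment]). *)
Definition coef_form (f : {poly F}) (y : X) : F := \sum_(i < m.+1) f`_i * y i 0.

Lemma coef_form0 f : coef_form f 0 = 0.
Proof. by rewrite /coef_form big1 // => i _; rewrite mxE mulr0. Qed.

Lemma coef_formD f c y z : coef_form f (y + c *: z) = coef_form f y + c * coef_form f z.
Proof.
rewrite mulr_sumr -big_split; apply: eq_bigr => i _ /=.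
by rewrite !mxE; ring.
Qed.

Lemma coef_form_moment f a : (size f <= m.+1)%N -> coef_form f (moment a) = f.[a].
Proof.
by move=> sf; rewrite (horner_coef_wide _ sf); apply: eq_bigr => i _; rewrite mxE.
Qed.

Lemma coef_form_delta f : coef_form f (delta_mx ord_max 0) = f`_m.
Proof.
rewrite /coef_form (bigD1 ord_max) //= mxE !eqxx mulr1 big1 ?addr0 // => i ne.
by rewrite mxE (negbTE ne) mulr0.
Qed.

(** The coordinates of u solve a Vandermonde system with distinct nodes. *)
Lemma moment_span (t : seq F) (u : X) : uniq t -> size t = m.+1 ->
  exists c : 'I_m.+1 -> F, u = \sum_i c i *: moment t`_i.
Proof.
move=> tu ts; pose V := Vandermonde m.+1 (\row_(j < m.+1) t`_j).
have Vu : V \in unitmx.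
  rewrite unitmxE unitfE det_Vandermonde; apply/prodf_neq0 => i _.
  apply/prodf_neq0 => j ij; rewrite !mxE subr_eq0 nth_uniq ?ts //.
  by rewrite gtn_eqF.
exists (fun i => (invmx V *m u) i 0); rewrite -[LHS](mulKVmx Vu).
apply/matrixP => i j; rewrite (ord1 j) mxE summxE; apply: eq_bigr => k _.
by rewrite !mxE mulrC.
Qed.

End MomentCurve.

(** * Translation operators on a finite abelian group *)

Section Translations.
Variables (R : realFieldType) (X : finZmodType).
Local Notation n := #|{: X}|.
Local Notation vtx := (enum_val : 'I_n -> X).

(** The operator sending a function y |-> x(y) on the group X to
y |-> x(y + u), the elements of X being numbered by their rank. *)
Definition translation (u : X) : 'M[R]_n :=
  \matrix_(i, j) (vtx j == vtx i + u)%:R.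

Lemma sum_pick (x : X) (g : 'I_n -> R) :
  \sum_j (vtx j == x)%:R * g j = g (enum_rank x).
Proof.
rewrite (bigD1 (enum_rank x)) //= enum_rankK eqxx mul1r big1 ?addr0 // => j ne.
by rewrite -(enum_rankK x) (inj_eq enum_val_inj) (negbTE ne) mul0r.
Qed.

Lemma translationE u p (x : 'M[R]_(n, p)) i j :
  (translation u *m x) i j = x (enum_rank (vtx i + u)) j.
Proof.
rewrite mxE -(sum_pick _ (x^~ j)); apply: eq_bigr => k _.
by rewrite mxE.
Qed.

Lemma translationD u w : translation u *m translation w = translation (u + w).
Proof.
by apply/matrixP => i j; rewrite translationE !mxE enum_rankK addrA.
Qed.

Lemma trmx_translation u : (translation u)^T = translation (- u).
Proof.
by apply/matrixP => i j; rewrite !mxE -subr_eq eq_sym.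
Qed.

Lemma translation_ones u : translation u *m const_mx 1 = const_mx 1 :> 'M[R]_n.
Proof. by apply/matrixP => i j; rewrite translationE !mxE. Qed.

(** The translations act simply transitively. *)
Lemma sum_translation : \sum_u translation u = const_mx 1.
Proof.
apply/matrixP => i j; rewrite summxE mxE (bigD1 (vtx j - vtx i)) //= big1.
  by rewrite mxE addr0 [X in _ == X]addrC subrK eqxx.
by move=> u ne; rewrite mxE addrC -subr_eq eq_sym (negbTE ne).
Qed.

End Translations.
Arguments translation R {X}.

(** * Averages along the directions of the moment curve *)

Section LineAverages.
Variables (R : realFieldType) (F : finFieldType) (m : nat).
Local Notation X := 'cV[F]_m.+1.
Local Notation n := #|{: X}|.
Local Notation vtx := (enum_val : 'I_n -> X).
Local Notation q := (#|F|%:R : R).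
Local Notation T := (@translation R X).
Local Notation ones := (const_mx 1 : 'M[R]_n).

Lemma card_field_gt0 : 0 < q. Proof. by rewrite ltr0n; apply/card_gt0P; exists 0. Qed.
Lemma card_field_neq0 : q != 0. Proof. by rewrite gt_eqF ?card_field_gt0. Qed.

Definition line_avg (a : F) : 'M[R]_n := q^-1 *: \sum_c T (c *: moment m a).

Lemma translation_line_avg c a : T (c *: moment m a) *m line_avg a = line_avg a.
Proof.
rewrite -scalemxAr mulmx_sumr; congr (_ *: _).
rewrite [RHS](reindex_inj (addrI c)) /=; apply: eq_bigr => d _.
by rewrite translationD scalerDl.
Qed.

Lemma line_avg_idem a : line_avg a *m line_avg a = line_avg a.
Proof.
rewrite {1}/line_avg -scalemxAl mulmx_suml.
under eq_bigr do rewrite translation_line_avg.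
by rewrite sumr_const -[line_avg a *+ _]scaler_nat scalerA mulVf
  ?card_field_neq0 // scale1r.
Qed.

Lemma line_avg_sym a : (line_avg a)^T = line_avg a.
Proof.
rewrite linearZ /= linear_sum /=; congr (_ *: _).
rewrite [RHS](reindex_inj oppr_inj) /=; apply: eq_bigr => d _.
by rewrite trmx_translation scaleNr.
Qed.

Lemma translation_line_avgC u a : T u *m line_avg a = line_avg a *m T u.
Proof.
rewrite -scalemxAr -scalemxAl mulmx_sumr mulmx_suml; congr (_ *: _).
by apply: eq_bigr => d _; rewrite !translationD addrC.
Qed.

Lemma line_avgC a b : line_avg a *m line_avg b = line_avg b *m line_avg a.
Proof.
rewrite {1}/line_avg -scalemxAl mulmx_suml -[in RHS]scalemxAr mulmx_sumr.
by congr (_ *: _); apply: eq_bigr => d _; rewrite translation_line_avgC.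
Qed.

Lemma line_avg_ones a : line_avg a *m ones = ones.
Proof.
rewrite -scalemxAl mulmx_suml; under eq_bigr do rewrite translation_ones.
by rewrite sumr_const -[ones *+ _]scaler_nat scalerA mulVf
  ?card_field_neq0 // scale1r.
Qed.

Lemma ones_line_avg a : ones *m line_avg a = ones.
Proof.
by apply: trmx_inj; rewrite trmx_mul line_avg_sym trmx_const line_avg_ones.
Qed.

Lemma line_avg_ge0 a i j : 0 <= line_avg a i j.
Proof.
rewrite mxE mulr_ge0 ?invr_ge0 ?ler0n // summxE sumr_ge0 // => c _.
by rewrite mxE ler0n.
Qed.

Lemma translation_mxprod c a t : a \in t ->
  T (c *: moment m a) *m mxprod line_avg t = mxprod line_avg t.
Proof.
elim: t => //= b t IH; rewrite inE mulmxA => /orP[/eqP <-|at_].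
  by rewrite translation_line_avg.
by rewrite translation_line_avgC -mulmxA IH.
Qed.

(** The product of the averages is invariant by translation along m+1
directions that span the space, hence by every translation: its values are
constant functions.  Averages preserve the sum, so a function of sum zero is
sent to a constant of sum zero. *)
Lemma mxprod_line_avg_kill t (x : 'cV[R]_n) : uniq t -> size t = m.+1 ->
  ones *m x = 0 -> mxprod line_avg t *m x = 0.
Proof.
move=> tu ts x0; set M := mxprod _ t.
have TM u : T u *m M = M.
  have [c ->] := moment_span u tu ts.
  apply: (big_ind (fun u => T u *m M = M)).
  - by apply/matrixP => i j; rewrite translationE addr0 enum_valK.
  - by move=> v w Tv Tw; rewrite -translationD -mulmxA Tw.
  - by move=> i _; rewrite translation_mxprod // mem_nth // ts.
have onesM : ones *m M = ones.
  rewrite /M; elim: (t) => [|a s IH] /=; first by rewrite mulmx1.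
  by rewrite mulmxA ones_line_avg.
have : n%:R *: (M *m x) = 0.
  rewrite -[RHS]x0 -[in RHS]onesM -mulmxA -sum_translation mulmx_suml.
  under eq_bigr do rewrite mulmxA TM.
  by rewrite sumr_const scaler_nat.
move/eqP; rewrite scaler_eq0 pnatr_eq0 => /orP[|/eqP //].
by rewrite -leqn0 leqNgt; case/negP; apply/card_gt0P; exists 0.
Qed.

End LineAverages.

(** * The lazy walk: spectrum *)

Section LazyWalk.
Variables (R : realType) (F : finFieldType) (m : nat).
Local Notation X := 'cV[F]_m.+1.
Local Notation n := #|{: X}|.
Local Notation vtx := (enum_val : 'I_n -> X).
Local Notation q := (#|F|%:R : R).
Local Notation P := (@line_avg R F m).
Local Notation ones := (const_mx 1 : 'M[R]_n).
Local Notation J := (averaging_mx R n).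
Hypothesis mF : (m < #|F|)%N.

Definition line_avg_sum : 'M[R]_n := \sum_a P a.
Local Notation N := line_avg_sum.

Definition lazy_walk (t : R) : 'M[R]_n := (1 - t)%:M + (t / q) *: N.

Lemma lazy_walk_sym t : (lazy_walk t)^T = lazy_walk t.
Proof.
rewrite linearD /= tr_scalar_mx linearZ /= linear_sum /=.
by congr (_ + _ *: _); apply: eq_bigr => a _; exact: line_avg_sym.
Qed.

Lemma lazy_walk_ones t : lazy_walk t *m ones = ones.
Proof.
rewrite mulmxDl mul_scalar_mx -scalemxAl mulmx_suml.
under eq_bigr do rewrite line_avg_ones.
rewrite sumr_const -[ones *+ _]scaler_nat scalerA divfK ?card_field_neq0 //.
by rewrite -scalerDl subrK scale1r.
Qed.

Lemma lazy_walk_stochastic t : doubly_stochastic (lazy_walk t).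
Proof.
have row i : \sum_j lazy_walk t i j = 1.
  have /matrixP/(_ i i) := lazy_walk_ones t; rewrite !mxE => <-.
  by apply: eq_bigr => j _; rewrite [const_mx _ _ _]mxE mulr1.
split=> // j; rewrite -(row j); apply: eq_bigr => i _.
by rewrite -[in LHS]lazy_walk_sym mxE.
Qed.

Lemma averaging_mxE : J = n%:R^-1 *: ones.
Proof.
by apply/matrixP => i j; rewrite !mxE big_ord1 !mxE mulr1.
Qed.

Lemma card_vertices_neq0 : (n%:R : R) != 0.
Proof. by rewrite pnatr_eq0 -lt0n; apply/card_gt0P; exists 0. Qed.

Lemma ones_averaging : ones *m J = ones.
Proof.
rewrite averaging_mxE -scalemxAr.
have -> : ones *m ones = n%:R *: ones.
  apply/matrixP => i j; rewrite !mxE mulr1.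
  under eq_bigr do rewrite !mxE mulr1.
  by rewrite sumr_const card_ord.
by rewrite scalerA mulVf ?card_vertices_neq0 // scale1r.
Qed.

Lemma averaging_sym : J^T = J.
Proof. by rewrite averaging_mxE linearZ /= trmx_const. Qed.

Lemma averaging_idem : J *m J = J.
Proof. by rewrite {1}averaging_mxE -scalemxAl ones_averaging -averaging_mxE. Qed.

Lemma lazy_walk_averaging t : lazy_walk t *m J = J.
Proof. by rewrite averaging_mxE -scalemxAr lazy_walk_ones. Qed.

Lemma lazy_walk_contraction t (x : 'cV[R]_n) : 0 < t -> t <= 1 ->
  sqnorm ((lazy_walk t - J) *m x) <= (1 - t + t * (m%:R / q)) ^+ 2 * sqnorm x.
Proof.
move=> t0 t1; set z := x - J *m x.
have q0 := card_field_gt0 R F.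
have z0 : ones *m z = 0 by rewrite mulmxBr mulmxA ones_averaging subrr.
(* The value of c for which (1 - t) I + (t / q) N = (t / q) (N + c I). *)
pose c := (1 - t) * q / t.
have c0 : 0 <= c by rewrite !mulr_ge0 ?subr_ge0 ?invr_ge0 // ltW.
have -> : (lazy_walk t - J) *m x = (t / q) *: (N *m z + c *: z).
  have -> : (lazy_walk t - J) *m x = lazy_walk t *m z.
    by rewrite mulmxBr mulmxA lazy_walk_averaging mulmxBl.
  rewrite mulmxDl mul_scalar_mx -scalemxAl [RHS]scalerDr addrC [in RHS]scalerA.
  by congr (_ + _ *: _); rewrite /c; field; rewrite !gt_eqF.
have zx : sqnorm z <= sqnorm x.
  rewrite [leRHS](sqnorm_projC _ averaging_sym averaging_idem) lerDr.
  exact: sqnorm_ge0.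
have Nz : sqnorm (N *m z + c *: z) <= (m%:R + c) ^+ 2 * sqnorm z.
  apply: sqnorm_sum_proj_le => //.
  - exact: line_avg_sym.
  - exact: line_avg_idem.
  - exact: line_avgC.
  - move=> s sF ss; apply: mxprod_line_avg_kill => //.
    by apply: subseq_uniq sF _; exact: index_enum_uniq.
rewrite sqnormZ; apply: (@le_trans _ _ ((t / q) ^+ 2 * ((m%:R + c) ^+ 2 * sqnorm x))).
  rewrite ler_wpM2l ?sqr_ge0 // (le_trans Nz) // ler_wpM2l ?sqr_ge0 //.
rewrite mulrA -exprMn le_eqVlt; apply/orP; left; apply/eqP.
by congr (_ ^+ 2 * _); rewrite /c; field; rewrite !gt_eqF.
Qed.

(* An arbitrary choice of m elements of F: the roots of f. *)
Let S := take m (enum F).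
Let f : {poly F} := \prod_(a <- S) ('X - a%:P).
Let g (c : F) : R := (c == 0)%:R - (c == 1)%:R.
(** A sum-zero function g of one linear form, the form being the one attached
to the polynomial with root set S.  It is an eigenvector for the eigenvalue
lambda. *)
Definition slow_mode : 'cV[R]_n := \col_i g (coef_form f (vtx i)).

Let size_S : size S = m.
Proof. by rewrite size_takel // -cardE ltnW. Qed.

Let size_f : size f = m.+1.
Proof. by rewrite size_prod_XsubC size_S. Qed.

Let lead_f : f`_m = 1.
Proof.
have /monicP : f \is monic by rewrite monic_prod_XsubC.
by rewrite lead_coefE size_f.
Qed.

Let sum_g : \sum_c g c = 0.
Proof.
have one x : \sum_(c : F) (c == x)%:R = 1 :> R.
  by rewrite (bigD1 x) //= eqxx big1 ?addr0 // => c /negbTE ->.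
by rewrite sumrB !one subrr.
Qed.

(** Along the direction of parameter a the form moves by multiples of f(a).  If
f(a) = 0 it does not move, and otherwise it takes each value of F once, so that
the average is that of g over F. *)
Lemma line_avg_slow_mode a : P a *m slow_mode = (a \in S)%:R *: slow_mode.
Proof.
rewrite -root_prod_XsubC -/f.
apply/matrixP => i j; rewrite ord1 -scalemxAl mulmx_suml mxE summxE.
under eq_bigr => c _.
  rewrite translationE mxE enum_rankK coef_formD coef_form_moment ?size_f //.
  over.
rewrite !mxE /root; case: eqVneq => [->|fa]; last first.
  have fi : injective (fun c => coef_form f (vtx i) + c * f.[a]).
    by move=> c d /addrI/(mulIf fa).
  have sum0 : \sum_c g (coef_form f (vtx i) + c * f.[a]) = 0.
    by rewrite -[RHS]sum_g [RHS](reindex_inj fi).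
  by rewrite sum0 mulr0 mul0r.
under eq_bigr do rewrite mulr0 addr0.
by rewrite sumr_const -[g _ *+ _]mulr_natl mulrA mulVf ?card_field_neq0.
Qed.

Lemma sum_slow_mode : N *m slow_mode = m%:R *: slow_mode.
Proof.
rewrite mulmx_suml; under eq_bigr do rewrite line_avg_slow_mode.
rewrite -scaler_suml; congr (_ *: _).
rewrite -natr_sum -[in RHS]size_S; congr (_%:R).
rewrite -(card_uniqP (take_uniq _ (enum_uniq _))) -sum1_card [RHS]big_mkcond /=.
by apply: eq_bigr => a _; case: (a \in S).
Qed.

(** As m < q, some average kills the slow mode, and averages preserve sums. *)
Lemma ones_slow_mode : ones *m slow_mode = 0.
Proof.
have [a aS] : exists a, a \notin S.
  case: (pickP [pred a | a \notin S]) => [a aS|all_S]; first by exists a.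
  have : (#|F| <= size S)%N.
    apply: leq_trans (card_size S); rewrite leq_eqVlt; apply/orP; left.
    by apply/eqP/eq_card => a; have /= /negbFE -> := all_S a.
  by rewrite size_S leqNgt mF.
rewrite -(ones_line_avg R m a) -mulmxA line_avg_slow_mode (negbTE aS).
by rewrite scale0r mulmx0.
Qed.

Lemma sqnorm_slow_mode_gt0 : 0 < sqnorm slow_mode.
Proof.
apply: (@sqnorm_gt0 _ _ _ (enum_rank (delta_mx ord_max 0))).
rewrite mxE enum_rankK coef_form_delta lead_f /g eqxx oner_eq0 sub0r.
by rewrite oppr_eq0 oner_eq0.
Qed.

Lemma mixing_lambda_lazy_walk t : 0 < t -> t <= 1 ->
  mixing_lambda (lazy_walk t) = 1 - t + t * (m%:R / q).
Proof.
move=> t0 t1; apply: (@spectral_normE _ _ _ _ slow_mode).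
- by rewrite addr_ge0 ?subr_ge0 // !mulr_ge0 ?invr_ge0 ?ler0n // ltW.
- by move=> x; exact: lazy_walk_contraction.
- rewrite mulmxBl averaging_mxE -[in X in _ - X]scalemxAl ones_slow_mode scaler0 subr0.
  rewrite mulmxDl mul_scalar_mx -scalemxAl sum_slow_mode scalerA -scalerDl.
  by congr (_ *: _); ring.
- exact: sqnorm_slow_mode_gt0.
Qed.

(** * The underlying graph: connectedness and diameter *)

(** The edges are defined without reference to t, as the diameter is used to
choose t. *)
Definition moment_edge : rel 'I_n := fun i j =>
  (i != j) && [exists a, exists c, vtx j == vtx i + c *: moment m a].
Local Notation e := moment_edge.

Lemma moment_edgeP i j :
  reflect (i != j /\ exists a c, vtx j = vtx i + c *: moment m a) (e i j).
Proof.
apply: (iffP andP) => -[-> H]; split=> //.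
  by have /existsP[a /existsP[c /eqP]] := H; exists a, c.
by case: H => a [c H]; apply/existsP; exists a; apply/existsP; exists c; apply/eqP.
Qed.

Lemma line_avg_sum_gt0 i j : i != j -> (0 < N i j <-> e i j).
Proof.
move=> ij; rewrite summxE; split=> [Npos|/moment_edgeP[_ [a [c vj]]]].
  apply: contraLR Npos; rewrite -leNgt => eij.
  rewrite big1 // => a _; rewrite mxE summxE big1 ?mulr0 // => c _.
  rewrite mxE; case: eqP => // vj; case/negP: eij.
  by apply/moment_edgeP; split=> //; exists a, c.
apply: (@lt_le_trans _ _ (P a i j)); last first.
  by rewrite (bigD1 a) //= lerDl sumr_ge0 // => b _; exact: line_avg_ge0.
rewrite mxE mulr_gt0 ?invr_gt0 ?card_field_gt0 // summxE (bigD1 c) //= mxE vj eqxx.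
by rewrite ltr_pwDl // sumr_ge0 // => d _; rewrite mxE ler0n.
Qed.

Lemma moment_edge_connected : connected_graph e.
Proof.
split.
- by rewrite card_ord; apply/card_gt0P; exists 0.
- move=> i j; apply/moment_edgeP/moment_edgeP => -[ij [a [c v]]];
    split; rewrite 1?eq_sym //; exists a, (- c); by rewrite v scaleNr addrK.
- by move=> i; rewrite /moment_edge eqxx.
move=> x y; pose t := take m.+1 (enum F).
have st : size t = m.+1 by rewrite size_takel // -cardE.
have [c uE] := moment_span (vtx y - vtx x) (take_uniq _ (enum_uniq F)) st.
pose K (u : X) := forall i, connect e i (enum_rank (vtx i + u)).
have : K (vtx y - vtx x).
  rewrite uE; apply: (big_ind K).
  - by move=> i; rewrite addr0 enum_valK.
  - move=> u w Ku Kw i; apply: connect_trans (Ku i) _.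
    by have := Kw (enum_rank (vtx i + u)); rewrite enum_rankK addrA.
  - move=> k _ i; set j := enum_rank _.
    have [<-|ij] := eqVneq i j; first exact: connect0.
    apply: connect1; apply/moment_edgeP; split=> //; exists t`_k, (c k).
    by rewrite enum_rankK.
by move=> /(_ x); rewrite addrC subrK enum_valK.
Qed.

Lemma graph_matrix_pair_lazy_walk t : 0 < t -> t <= 1 ->
  graph_matrix_pair e (lazy_walk t).
Proof.
move=> t0 t1; have tq : 0 < t / q by rewrite divr_gt0 ?card_field_gt0.
split; first exact: moment_edge_connected.
split=> [i j|||i j ij].
- rewrite !mxE addr_ge0 ?mulrn_wge0 ?subr_ge0 //.
  apply: mulr_ge0; first exact: ltW.
  by rewrite summxE sumr_ge0 // => a _; exact: line_avg_ge0.
- exact: lazy_walk_sym.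
- exact: lazy_walk_stochastic.
- by rewrite !mxE (negbTE ij) mulr0n add0r pmulr_rgt0 //; exact: line_avg_sum_gt0.
Qed.

(** The list rs collects the parameters of the directions used along the path:
a form attached to a polynomial vanishing on rs does not change at any step. *)
Lemma path_invariant_form x s : path e x s ->
  exists2 rs : seq F, size rs = size s &
    forall h : {poly F}, (size h <= m.+1)%N -> all (root h) rs ->
      coef_form h (vtx (last x s)) = coef_form h (vtx x).
Proof.
elim: s x => [|y s IH] x /=; first by exists [::].
move=> /andP[/moment_edgeP[_ [a [c vy]]] /IH[rs srs hrs]].
exists (a :: rs); first by rewrite /= srs.
move=> h sh /= /andP[/rootP ha hr]; rewrite hrs // vy coef_formD.
by rewrite coef_form_moment // ha mulr0 addr0.
Qed.

(** A path with at most m steps leaves invariant the form attached to some monic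
polynomial of degree m.  That form is 0 at 0 and 1 at the last basis vector, so
the path cannot join these two vertices. *)
Lemma diameter_gt : (m < diameter e)%N.
Proof.
pose x := enum_rank (0 : X); pose y := enum_rank (delta_mx ord_max 0 : X).
suff dxy : (m < graph_dist e x y)%N.
  apply: leq_trans dxy _; apply: leq_trans (leq_bigmax (F := graph_dist e x) y) _.
  exact: (leq_bigmax (F := fun x => (\max_y graph_dist e x y)%N)).
rewrite /graph_dist; apply: (big_ind (fun k => (m < k)%N)).
(* The default value of the minimum is the number of vertices, q^(m+1). *)
- rewrite card_ord card_mx muln1; apply: ltn_trans (ltnSn m) _.
  by apply: ltn_expl; exact: card_finNzRing_gt1.
- by move=> a b ma mb; rewrite leq_min ma.
move=> k /existsP[s /andP[es /eqP ls]]; rewrite ltnNge; apply/negP => km.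
have [rs srs hrs] := path_invariant_form es.
(* Padding by zeros makes the degree exactly m, so that h`_m = 1. *)
pose h : {poly F} := \prod_(a <- rs ++ nseq (m - k) 0) ('X - a%:P).
have sh : size h = m.+1.
  by rewrite size_prod_XsubC size_cat srs size_tuple size_nseq subnKC.
have hm : h`_m = 1.
  have /monicP : h \is monic by rewrite monic_prod_XsubC.
  by rewrite lead_coefE sh.
have := hrs h; rewrite sh ls !enum_rankK coef_form_delta coef_form0 hm.
move=> /(_ (leqnn _)) H; have /eqP := oner_neq0 F; apply; apply: H.
by apply/allP => a ars; rewrite root_prod_XsubC mem_cat ars.
Qed.

End LazyWalk.

(** * Choice of the parameters *)

Unset Implicit Arguments.

Theorem theorem2p3 (R : realType) (p D0 : R) (hp : 0 < p) (hD0 : 1 <= D0) :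
  exists (n : nat) (e : rel 'I_n) (W : 'M[R]_n),
    [/\ graph_matrix_pair e W,
        mixing_lambda W < 1,
        D0 <= (diameter e)%:R &
        mixing_tau W = (diameter e)%:R `^ p].
Proof.
(* m >= 2^(1/p) ensures D^p >= 2. *)
pose m := Num.bound (Num.max D0 (2 `^ p^-1)).
have mb : Num.max D0 (2 `^ p^-1) <= m%:R.
  by apply/ltW/archi_boundP; rewrite le_max powR_ge0 orbT.
have [q qm q_prime] := prime_above (m + m).
have cF : #|'F_q| = q by rewrite card_Fp.
have mF : (m < #|'F_q|)%N by rewrite cF (leq_ltn_trans _ qm) ?leq_addr.
set D := diameter (@moment_edge 'F_q m).
have mD : (m%:R : R) <= D%:R by rewrite ler_nat ltnW // diameter_gt.
have D0D : D0 <= D%:R.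
  by apply: le_trans mD; apply: le_trans mb; rewrite le_max lexx.
have D2 : 2 <= (D%:R : R) `^ p.
  have -> : 2 = (2 `^ p^-1) `^ p :> R.
    by rewrite -powRrM mulVf ?gt_eqF // powRr1.
  apply: (ge0_ler_powR (ltW hp)); rewrite ?nnegrE ?powR_ge0 ?ler0n //.
  by apply: le_trans mD; apply: le_trans mb; rewrite le_max lexx orbT.
set T := _ `^ p in D2 *.
pose r : R := m%:R / #|'F_q|%:R.
have r2 : r <= 1 / 2.
  have mq : (m + m)%:R <= q%:R :> R by rewrite ler_nat ltnW.
  rewrite /r cF ler_pdivrMr ?ltr0n ?prime_gt0 //.
  by rewrite natrD in mq; lra.
pose t := T^-1 / (1 - r).
have T0 : 0 < T by lra.
have t0 : 0 < t by rewrite divr_gt0 ?invr_gt0 //; lra.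
have t1 : t <= 1.
  rewrite ler_pdivrMr ?mul1r; last by lra.
  apply: (@le_trans _ _ 2^-1); last by lra.
  by rewrite lef_pV2 ?posrE //; lra.
have lam : mixing_lambda (lazy_walk 'F_q m t) = 1 - T^-1.
  rewrite mixing_lambda_lazy_walk // -/r /t; field.
  by apply/andP; split; rewrite gt_eqF //; lra.
exists _, (@moment_edge 'F_q m), (lazy_walk 'F_q m t); split.
- exact: graph_matrix_pair_lazy_walk.
- by rewrite lam ltrBlDr ltrDl invr_gt0.
- exact: D0D.
- by rewrite /mixing_tau lam opprB addrC subrK div1r invrK.
Qed.
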